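(* Let $X$ be a Gromov product space whose Gromov product boundary $\partial_PX$ has at least four points. Then the map $i_X:X\to\mathcal{M}(\partial_PX)$, $x\mapsto\rho_x$, is an isometric (distance-preserving) embedding. Moreover, $i_X$ extends to a continuous map $\widehat{i_X}:\widehat X^P=X\sqcup\partial_PX\to\widehat{\mathcal{M}(\partial_PX)}=\mathcal{M}(\partial_PX)\sqcup\partial_PX$ whose restriction to $\partial_PX$ is the identity map $\partial_PX\to\partial_PX$.
   Context: Antipodal spaces and Moebius spaces. Let $Z$ be a compact metrizable space containing at least four points. A separating function on $Z$ is a continuous function $\rho : Z\times Z\to[0,\infty)$ which is symmetric and satisfies $\rho(\xi,\eta)=0$ if and only if $\xi=\eta$. Its cross-ratio is defined on quadruples of distinct points of $Z$ by $[\xi,\xi',\eta,\eta']_\rho=\frac{\rho(\xi,\eta)\rho(\xi',\eta')}{\rho(\xi,\eta')\rho(\xi',\eta)}$. Two separating functions are Moebius equivalent if their cross-ratios agree. If $\rho_1,\rho_2$ are Moebius equivalent, there is a unique positive continuous function $\frac{d\rho_2}{d\rho_1}:Z\to(0,\infty)$, the derivative, such that $\rho_2(\xi,\eta)^2=\frac{d\rho_2}{d\rho_1}(\xi)\frac{d\rho_2}{d\rho_1}(\eta)\rho_1(\xi,\eta)^2$ for all $\xi,\eta\in Z$. An antipodal function on $Z$ is a separating function $\rho$ such that $\sup_{\xi,\eta}\rho(\xi,\eta)=1$ and for every $\xi\in Z$ there is $\eta\in Z$ with $\rho(\xi,\eta)=1$. An antipodal space $(Z,\rho_0)$ is such a space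 $Z$ equipped with an antipodal function $\rho_0$. Its Moebius space $\mathcal{M}(Z)=\mathcal{M}(Z,\rho_0)$ is the set of all antipodal functions on $Z$ Moebius equivalent to $\rho_0$, with the metric $d_{\mathcal{M}}(\rho_1,\rho_2)=\left\|\log\frac{d\rho_2}{d\rho_1}\right\|_\infty$. Maxima compactification. The maxima compactification of $\mathcal{M}(Z)$ is the set $\widehat{\mathcal{M}(Z)}=\mathcal{M}(Z)\sqcup Z$ with the topology having as basis the open balls of $\mathcal{M}(Z)$ together with the sets $N(U,\rho_1,r)=U\sqcup\{\rho\in\mathcal{M}(Z): \operatorname{argmax}\frac{d\rho}{d\rho_1}\subset U,\ d_{\mathcal{M}}(\rho,\rho_1)>r\}$, for $U\subset Z$ open and $r>0$, where $\rho_1\in\mathcal{M}(Z)$ is fixed and $\operatorname{argmax}g$ is the set of points where $g$ attains its maximum. This topology is compact Hausdorff and does not depend on $\rho_1$. Gromov product spaces. A metric space is proper if closed balls are compact, and geodesically complete if every geodesic segment extends to a bi-infinite geodesic. $(y|z)_x=\frac12(d(x,y)+d(x,z)-d(y,z))$. A proper, geodesic, geodesically complete metric space $X$ is a Gromov product space if there is a second countable Hausdorff compactification $\widehat X$ of $X$ such that for every $x\in X$ the Gromov product $(\cdot|\cdot)_x:X\times X\to[0,+\infty)$ extends to a continuous function $\widehat X\times\widehat X\to[0,+\infty]$ such that for $\xi,\eta\in\widehat X\setminus X$, $(\xi|\eta)_x=+\infty$ if and only if $\xi=\eta$. Such a compactification is unique up to equivalence; it is denoted $\widehat X^P$, and $\partial_PX:=\widehat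 X^P\setminus X$ is the Gromov product boundary. For $x\in X$ set $\rho_x=e^{-(\cdot|\cdot)_x}$ on $\partial_PX\times\partial_PX$. When $\partial_PX$ has at least four points, the $\rho_x$ are antipodal functions on $\partial_PX$, all Moebius equivalent; $\partial_PX$ is regarded as an antipodal space with any of them, and $\mathcal{M}(\partial_PX)=\mathcal{M}(\partial_PX,\rho_x)$ does not depend on $x$. *)

(* Defs.v *)
From HB Require Import structures.
From mathcomp Require Import all_boot all_order all_algebra.
From mathcomp Require Import all_classical all_reals all_analysis.

Set Implicit Arguments.
Unset Strict Implicit.
Unset Printing Implicit Defensive.

Import Order.TTheory GRing.Theory Num.Theory.
Import numFieldNormedType.Exports.

Local Open Scope classical_set_scope.
Local Open Scope ring_scope.

Section AntipodalSpaces.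
Context {R : realType} {Z : topologicalType}.
Implicit Types (rho : Z * Z -> R).

Definition separating_function rho : Prop :=
  [/\ continuous rho,
      forall xi eta, 0 <= rho (xi, eta),
      forall xi eta, rho (xi, eta) = rho (eta, xi) &
      forall xi eta, rho (xi, eta) = 0 <-> xi = eta].

Definition cross_ratio rho (xi xi' eta eta' : Z) : R :=
  (rho (xi, eta) * rho (xi', eta')) / (rho (xi, eta') * rho (xi', eta)).

Definition moebius_equivalent rho1 rho2 : Prop :=
  forall xi xi' eta eta' : Z, uniq [:: xi; xi'; eta; eta'] ->
    cross_ratio rho1 xi xi' eta eta' = cross_ratio rho2 xi xi' eta eta'.

(* [sup] is 0 on unbounded sets, so the second clause also says that [rho] is
   bounded. *)
Definition antipodal_function rho : Prop :=
  [/\ separating_function rho,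
      sup (range rho) = 1 &
      forall xi, exists eta, rho (xi, eta) = 1].

Definition is_moebius_derivative rho2 rho1 (g : Z -> R) : Prop :=
  [/\ continuous g,
      forall xi, 0 < g xi &
      forall xi eta, rho2 (xi, eta) ^+ 2 = g xi * g eta * rho1 (xi, eta) ^+ 2].

(* d rho2 / d rho1, with an irrelevant default value when there is none. *)
Definition moebius_derivative rho2 rho1 : Z -> R :=
  xget (cst 1) [set g | is_moebius_derivative rho2 rho1 g].

Definition sup_norm (f : Z -> R) : R := sup (range (fun z => `|f z|)).

Definition argmax (g : Z -> R) : set Z := [set z | forall w, g w <= g z].

Definition moebius_space (rho0 : Z * Z -> R) : Type :=
  set_type [set rho | antipodal_function rho /\ moebius_equivalent rho rho0].

Definition moebius_dist rho0 (rho1 rho2 : moebius_space rho0) : R :=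
  sup_norm (fun z => ln (moebius_derivative (\val rho2) (\val rho1) z)).

(* The disjoint union of the Moebius space and Z; the base point [rho1] only
   serves to define the topology. *)
Definition maxima_compactification rho0 (rho1 : moebius_space rho0) : Type :=
  (moebius_space rho0 + Z)%type.

HB.instance Definition _ rho0 (rho1 : moebius_space rho0) :=
  Choice.copy (maxima_compactification rho1) (moebius_space rho0 + Z)%type.

Definition maxima_ball rho0 (rho1 rho : moebius_space rho0) (e : R) :
    set (maxima_compactification rho1) :=
  inl @` [set rho' | moebius_dist rho rho' < e].

(* N(U, rho1, r) *)
Definition maxima_nbhd rho0 (rho1 : moebius_space rho0) (U : set Z) (r : R) :
    set (maxima_compactification rho1) :=
  inr @` U `|`
  inl @` [set rho : moebius_space rho0 |
            argmax (moebius_derivative (\val rho) (\val rho1)) `<=` U /\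
            r < moebius_dist rho rho1].

Definition maxima_basis rho0 (rho1 : moebius_space rho0) :
    set (set (maxima_compactification rho1)) :=
  [set B | (exists (rho : moebius_space rho0) (e : R),
              0 < e /\ B = @maxima_ball rho0 rho1 rho e) \/
           (exists (U : set Z) (r : R),
              [/\ open U, 0 < r & B = @maxima_nbhd rho0 rho1 U r])].

(* The topology generated by [maxima_basis]. Generating it from a subbase
   needs no side condition; for Z and rho0 as in the theory of antipodal spaces
   the family is a basis, and then this is the topology having it as basis. *)
HB.instance Definition _ rho0 (rho1 : moebius_space rho0) :=
  isSubBaseTopological.Build (maxima_compactification rho1)
    (@maxima_basis rho0 rho1) idfun.

End AntipodalSpaces.

Arguments maxima_ball {R Z rho0} rho1 rho e.
Arguments maxima_nbhd {R Z rho0} rho1 U r.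
Arguments maxima_basis {R Z rho0} rho1.

Section GromovProductSpaces.
Context {R : realType}.

Definition proper_metric (X : metricType R) : Prop :=
  forall (x : X) (r : R), compact [set y | mdist x y <= r].

Definition isometric_on (X : metricType R) (A : set R) (c : R -> X) : Prop :=
  forall s t, A s -> A t -> mdist (c s) (c t) = `|s - t|.

Definition geodesic_metric (X : metricType R) : Prop :=
  forall x y : X, exists c : R -> X,
    [/\ isometric_on `[0, mdist x y] c, c 0 = x & c (mdist x y) = y].

Definition geodesically_complete (X : metricType R) : Prop :=
  forall (a b : R) (c : R -> X), a < b -> isometric_on `[a, b] c ->
    exists c' : R -> X,
      isometric_on [set: R] c' /\ {in `[a, b], forall t, c' t = c t}.

Definition gromov_product (X : metricType R) (x y z : X) : R :=
  2^-1 * (mdist x y + mdist x z - mdist y z).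

(* [j] is a second countable Hausdorff compactification: the third clause says
   that the injection [j] is a homeomorphism onto its image. *)
Definition sc_hausdorff_compactification (X Xhat : topologicalType)
    (j : X -> Xhat) : Prop :=
  [/\ compact [set: Xhat] /\ hausdorff_space Xhat,
      @second_countable Xhat,
      injective j /\
        (forall U : set X, open U <-> exists2 V, open V & U = j @^-1` V) &
      dense (range j)].

(* Continuous extension of (.|.)_x to Xhat x Xhat -> [0, +oo], infinite on the
   boundary exactly along the diagonal. *)
Definition is_gromov_extension (X : metricType R) (Xhat : topologicalType)
    (j : X -> Xhat) (x : X) (G : Xhat * Xhat -> \bar R) : Prop :=
  [/\ continuous G,
      forall p, (0 <= G p)%E,
      forall y z : X, G (j y, j z) = (gromov_product x y z)%:E &
      forall xi eta, (~` range j) xi -> (~` range j) eta ->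
        G (xi, eta) = +oo%E <-> xi = eta].

Definition gromov_product_compactification (X : metricType R)
    (Xhat : topologicalType) (j : X -> Xhat) : Prop :=
  sc_hausdorff_compactification j /\
  forall x, exists G, is_gromov_extension j x G.

Definition gromov_product_space (X : metricType R) : Prop :=
  [/\ proper_metric X, geodesic_metric X, geodesically_complete X &
      exists (Xhat : topologicalType) (j : X -> Xhat),
        gromov_product_compactification j].

Definition gromov_boundary (X : metricType R) (Xhat : topologicalType)
    (j : X -> Xhat) : topologicalType := set_type (~` range j).

(* The extension is unique, as X x X is dense in Xhat x Xhat. *)
Definition gromov_extension (X : metricType R) (Xhat : topologicalType)
    (j : X -> Xhat) (x : X) : Xhat * Xhat -> \bar R :=
  xget (cst 0%E) [set G | is_gromov_extension j x G].

Definition visual_function (X : metricType R) (Xhat : topologicalType)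
    (j : X -> Xhat) (x : X) : gromov_boundary j * gromov_boundary j -> R :=
  fun p => fine (expeR (- gromov_extension j x (\val p.1, \val p.2))%E).

End GromovProductSpaces.

Arguments visual_function {R X Xhat} j x.

(* Main.v *)
From mathcomp Require Import finmap.
Require Import Defs.
From mathcomp Require Import all_boot all_order all_algebra.
From mathcomp Require Import all_classical all_reals all_analysis.
From mathcomp Require Import ring lra.

(** All the objects of the theorem are expressed through one family of
    real-valued functions on the compactification,
    [K x (a, b) = exp (- (a | b)_x)].  Each [K x] is continuous on the product
    of the compactification with itself, takes its values in [0, 1], restricts
    to [rho_x] on the boundary, and satisfies [K x (y, y) = exp (- d (x, y))]
    for [y] in [X]; hence the boundary is exactly the zero set of
    [a |-> K x (a, a)].  As [X] is dense, every identity or weak inequality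
    between continuous expressions in these kernels has to be checked for
    points of [X] only, where it is a formula about distances.

    The functions [rho_x] are antipodal: in [X], the reflection of [y] through
    [x] along a complete geodesic gives [z] with [(y | z)_x = 0] and
    [d (x, z) = d (x, y)], and these two closed conditions survive in the limit
    by compactness ([boundary_antipode]).

    The change of base point is governed by
    [2 (a | b)_x - 2 (a | b)_y = beta a + beta b] with
    [beta a = d (x, a) - d (y, a) = 2 (y | a)_x - d (x, y)].  The right-hand
    side extends to the boundary, so [exp beta] is the derivative of [rho_y]
    with respect to [rho_x] ([visual_kernel_change]).  Clearly
    [|beta| <= d (x, y)], and the value [d (x, y)] is attained at the endpoint
    of a geodesic ray from [x] through [y] ([busemann_factor_attained]).  Hence
    the supremum of [|beta|] over the boundary is [d (x, y)], which is the
    isometry statement.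

    For the extension, [i_X] on [X] is glued with the identity on the boundary
    and the preimages of the generating open sets are computed.  The preimage
    of a ball is open because [i_X] is isometric, the distance of the Moebius
    space satisfies the triangle inequality, and [X] is open in its
    compactification.  The triangle inequality needs the derivative between
    two arbitrary Moebius equivalent functions, which is constructed from the
    cross-ratios ([is_moebius_derivative_exists]).  The preimage of
    [N (U, rho_1, r)] is the intersection of two complements of closed sets.
    One is the image of [{x | d (rho_1, i_X x) <= r}], compact as [X] is
    proper.  For the other, let [k] be the derivative of [rho_1] with respect
    to [rho_x0].  For [x] in [X], the maximizers of the derivative of [rho_x]
    with respect to [rho_1] are the minimizers of
    [eta |-> K x0 (x, eta)^2 * k eta].  This makes sense for every point [a] of
    the compactification in place of [x], and for a boundary point [xi] the
    only minimizer is [xi], since the value there is 0.  So the condition that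
    all minimizers lie in [U] describes both halves of [N (U, rho_1, r)] at
    once, and it is open in [a] because the projection of a closed set along a
    compact factor is closed ([open_maxima_nbhd]). *)

Set Implicit Arguments.
Unset Strict Implicit.
Unset Printing Implicit Defensive.

Import Order.TTheory GRing.Theory Num.Theory.
Import numFieldNormedType.Exports.

Local Open Scope classical_set_scope.
Local Open Scope ring_scope.

(** * Topological and cardinality preliminaries *)

Lemma exists_notin_seq (Z : choiceType) (n : nat) (s : seq Z) :
  (`I_n #<= [set: Z])%card -> (size s < n)%N -> exists z, z \notin s.
Proof.
move=> /card_leP[f]; apply: contraPP => /forallNP sP; apply/negP; rewrite -leqNgt.
pose g (i : 'I_n) := \val (f (exist _ (i : nat) (@mem_set _ `I_n _ (ltn_ord i)))).
have gI : injective g.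
  move=> a b /val_inj/(inj (in_setT _) (in_setT _))E.
  by apply: val_inj; case: E.
rewrite -[leqLHS](size_enum_ord n) -(size_map g) uniq_leq_size//.
  by rewrite map_inj_uniq ?enum_uniq.
by move=> z _; exact/negPn/negP/sP.
Qed.

Section SliceContinuity.
Context {S T U : topologicalType}.

Lemma continuous_slicel (f : S * T -> U) (t : T) :
  continuous f -> continuous (fun s => f (s, t)).
Proof.
by move=> fc s; apply: (cvg_comp _ _ (cvg_pair cvg_id (cvg_cst t))); exact: fc.
Qed.

Lemma continuous_slicer (f : S * T -> U) (s : S) :
  continuous f -> continuous (fun t => f (s, t)).
Proof.
by move=> fc t; apply: (cvg_comp _ _ (cvg_pair (cvg_cst s) cvg_id)); exact: fc.
Qed.
End SliceContinuity.

Lemma closed_le_continuous {R : realType} {T : topologicalType} (f g : T -> R) :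
  continuous f -> continuous g -> closed [set t | f t <= g t].
Proof.
move=> fc gc; have -> : [set t | f t <= g t] =
    (fun t => g t - f t) @^-1` [set r | 0 <= r].
  by apply/seteqP; split=> t /=; rewrite subr_ge0.
apply: closed_comp; last exact: closed_ge.
by move=> t _; apply: cvgB; [exact: gc|exact: fc].
Qed.

Lemma closed_eq_continuous {R : realType} {T : topologicalType} (f g : T -> R) :
  continuous f -> continuous g -> closed [set t | f t = g t].
Proof.
move=> fc gc; have -> : [set t | f t = g t] =
    [set t | f t <= g t] `&` [set t | g t <= f t].
  apply/seteqP; split=> [t /= ->//|t /= [a b]].
  by apply/eqP; rewrite eq_le a b.
by apply: closedI; exact: closed_le_continuous.
Qed.

Lemma closed_dense {T : topologicalType} (D A : set T) :
  dense D -> closed A -> D `<=` A -> forall t, A t.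
Proof.
move=> dD cA DA t; apply: contrapT => nAt.
have [|s [/= nAs /DA//]] := dD (~` A) (ex_intro _ t nAt).
exact: closed_openC.
Qed.

Lemma dense_setX {S T : topologicalType} (D : set S) (E : set T) :
  dense D -> dense E -> dense (D `*` E).
Proof.
move=> dD dE O [[s t] Ost] oO.
have : nbhs (s, t) O by exact: open_nbhs_nbhs.
move=> [[P Q] /= [sP tQ] PQO].
have interior_meets (U : topologicalType) (F : set U) (u : U) (N : set U) :
    dense F -> nbhs u N -> exists2 v, N v & F v.
  move=> dF; rewrite nbhsE => -[N' [oN' N'u] N'N].
  by have [v [/N'N]] := dF N' (ex_intro _ u N'u) oN'; exists v.
have [s' Ps' Ds'] := interior_meets _ _ _ _ dD sP.
have [t' Qt' Et'] := interior_meets _ _ _ _ dE tQ.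
by exists (s', t'); split => //; exact: PQO.
Qed.

Lemma closed_projection {S T : topologicalType} (K : set (S * T)) :
  hausdorff_space S -> compact [set: S] -> compact [set: T] -> closed K ->
  closed (fst @` K).
Proof.
move=> hS cS cT cK; apply: compact_closed => //.
apply: continuous_compact; first by apply: continuous_subspaceT => p; exact: cvg_fst.
apply: (subclosed_compact cK (compact_setX cS cT)).
by move=> [].
Qed.

(** Continuity fails at [-oo], where [expeR (- u)] is infinite and [fine]
    truncates it to 0; hence the sign condition. *)
Lemma fine_expeRN_continuous {R : realType} (u : \bar R) : (0 <= u)%E ->
  {for u, continuous (fun v : \bar R => fine (expeR (- v)))}.
Proof.
case: u => [r _|_|//].
- have E : expR (- r) @[r --> r] --> expR (- r).
    by apply: continuous_comp; [exact: opp_continuous|exact: continuous_expR].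
  by move=> A /E; rewrite /= !near_simpl.
- suff : fine (expeR (- v)) @[v --> (+oo : \bar R)%E] --> (0 : R) by [].
  have FF : Filter (nbhs (+oo : \bar R)%E) by exact: nbhs_filter.
  apply/(@cvgr0Pnorm_lt _ _ _ _ FF) => e e0; apply/nbhs_ereal_pinfty; split.
    by rewrite /= normr0.
  exists (- ln e); split=> [|t et]; first exact: num_real.
  rewrite /= gtr0_norm ?expR_gt0// -[ltRHS]lnK ?posrE// ltr_expR.
  by rewrite ltrNl.
Qed.

Lemma continuous_sqr {R : realType} {T : topologicalType} (f : T -> R) :
  continuous f -> continuous (fun t => f t ^+ 2).
Proof.
move=> fc t; have -> : (fun t => f t ^+ 2) = (fun t => f t * f t) by [].
by apply: cvgM; exact: fc.
Qed.

(** A cluster point in [T] of the image of a filter on [A] lies in the closed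
    set [A], and is then a cluster point for the initial topology. *)
Lemma compact_set_type {T : topologicalType} (A : set T) :
  compact [set: T] -> closed A -> compact [set: set_type A].
Proof.
move=> cT cA F FF _.
have [p [_ Fp]] := cT (\val @ F) _ filterT.
have Ap : A p.
  apply: cA => B /(Fp _ _ _)-/(_ A) [].
    by apply: nearW => a /=; exact: set_valP.
  by move=> q [Aq Bq]; exists q.
exists (exist _ p (mem_set Ap)); split=> // B U FB [_ [[W oW <-] /= Wp WU]].
have FB' : F (\val @^-1` (\val @` B)).
  by apply: filterS FB; exact: preimage_image.
have [_ [[b Bb <-] Wb]] := Fp _ _ FB' (open_nbhs_nbhs (conj oW Wp)).
by exists b; split=> //; exact: WU.
Qed.

Lemma lipschitz1_continuous {R : realType} {X : metricType R} (f : X -> R) :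
  (forall x y, f x <= f y + mdist x y) -> continuous f.
Proof.
move=> fL x; apply/cvgrPdist_lt => e e0.
have : nbhs x (ball x e) by exact: nbhsx_ballx.
apply: filterS => y; rewrite ballEmdist /= => xye.
rewrite (le_lt_trans _ xye)// ler_distl.
have := fL x y; have := fL y x; rewrite [mdist y x]metric_sym; lra.
Qed.

(** * Derivatives of Moebius equivalent functions *)

(** On a set of at least three points, a positive symmetric function [f] of
    pairs of distinct points has the form [f x y ^+ 2 = g x * g y] as soon as
    it satisfies the exchange relation below: one must have
    [g x = f x y * f x z / f y z], and the relation makes this expression
    depend on [x] only. *)
Section ProductForm.
Context {R : realType} {Z : eqType} (f : Z -> Z -> R).
Context (fC : forall x y, f x y = f y x) (f_gt0 : forall x y, x != y -> 0 < f x y)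
  (f_exchange : forall x x' y y', uniq [:: x; x'; y; y'] ->
    f x y * f x' y' = f x y' * f x' y).

Definition factor x y z := f x y * f x z / f y z.

Let factorC x y z : factor x y z = factor x z y.
Proof. by rewrite /factor [f y z]fC [f x y * _]mulrC. Qed.

Let factor_move x y z z' : uniq [:: x; y; z] -> uniq [:: x; y; z'] ->
  factor x y z = factor x y z'.
Proof.
have [->//|zz'] := eqVneq z z'.
rewrite /= !inE !negb_or /= !andbT => /andP[/andP[xy xz] yz] /andP[/andP[_ xz'] yz'].
have := @f_exchange x y z z'.
rewrite /= !inE !negb_or xy xz xz' yz yz' zz' => /(_ isT) E.
have n1 : f y z != 0 by rewrite gt_eqF// f_gt0.
have n2 : f y z' != 0 by rewrite gt_eqF// f_gt0.
rewrite /factor; apply/eqP; rewrite eqr_div//; apply/eqP.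
by rewrite -!mulrA E.
Qed.

Lemma factor_indep x y z y' z' : uniq [:: x; y; z] -> uniq [:: x; y'; z'] ->
  factor x y z = factor x y' z'.
Proof.
have swap (a b c : Z) : uniq [:: a; b; c] -> uniq [:: a; c; b].
  rewrite /= !inE !negb_or => /and3P[/andP[-> ->]].
  by rewrite eq_sym => ->.
move=> u u'; have [y'z|y'z] := eqVneq y' z.
  (* [factor_move] replaces the last point only, and an intermediate triple
     made of [x], [z] and [y'] is available only when [y' != z]. *)
  by rewrite factorC -y'z; apply: factor_move => //; rewrite y'z; exact: swap.
have w : uniq [:: x; z; y'].
  move: u u'; rewrite /= !inE !negb_or /= !andbT => /andP[/andP[_ ->] _].
  by move=> /andP[/andP[-> _] _]; rewrite eq_sym.
rewrite factorC (factor_move (swap _ _ _ u) w) factorC; apply: factor_move => //.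
exact: swap.
Qed.

Lemma factor_gt0 x y z : uniq [:: x; y; z] -> 0 < factor x y z.
Proof.
rewrite /= !inE !negb_or andbT => /andP[/andP[xy xz] yz].
by rewrite /factor divr_gt0 ?mulr_gt0// f_gt0.
Qed.

Lemma factorM x y z : uniq [:: x; y; z] ->
  factor x y z * factor y x z = f x y ^+ 2.
Proof.
rewrite /= !inE !negb_or andbT => /andP[/andP[xy xz] yz].
have n1 : f x z != 0 by rewrite gt_eqF// f_gt0.
have n2 : f y z != 0 by rewrite gt_eqF// f_gt0.
by rewrite /factor [f y x]fC; field; rewrite n1 n2.
Qed.

End ProductForm.

Section MoebiusDerivative.
Context {R : realType} {Z : topologicalType}.
Implicit Types (rho : Z * Z -> R) (g h : Z -> R).

Lemma separating_gt0 rho xi eta :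
  separating_function rho -> xi != eta -> 0 < rho (xi, eta).
Proof.
move=> [_ r0 _ rE] xe; rewrite lt_neqAle r0 andbT eq_sym.
by apply: contra xe => /eqP/rE ->.
Qed.

Lemma separating_neq0 rho xi eta :
  separating_function rho -> xi != eta -> rho (xi, eta) != 0.
Proof. by move=> sr xe; rewrite gt_eqF// separating_gt0. Qed.

Lemma is_moebius_derivative_comp rho1 rho2 rho3 g h :
  is_moebius_derivative rho3 rho2 g -> is_moebius_derivative rho2 rho1 h ->
  is_moebius_derivative rho3 rho1 (fun z => g z * h z).
Proof.
move=> [gc g0 gE] [hc h0 hE]; split=> [z|z|xi eta].
- by apply: cvgM; [exact: gc|exact: hc].
- by rewrite mulr_gt0.
- by rewrite gE hE; ring.
Qed.

Lemma is_moebius_derivative_inv rho1 rho2 g :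
  is_moebius_derivative rho2 rho1 g ->
  is_moebius_derivative rho1 rho2 (fun z => (g z)^-1).
Proof.
move=> [gc g0 gE]; split=> [z|z|xi eta].
- by apply: cvgV; [rewrite gt_eqF|exact: gc].
- by rewrite invr_gt0.
- by rewrite gE; field; rewrite !gt_eqF.
Qed.

(** The products [g x * g y] are prescribed for [x != y], and a third point
    recovers [g x ^+ 2 = (g x * g y) * (g x * g z) / (g y * g z)]. *)
Lemma is_moebius_derivative_unique rho1 rho2 g h :
  (`I_3 #<= [set: Z])%card -> separating_function rho1 ->
  is_moebius_derivative rho2 rho1 g -> is_moebius_derivative rho2 rho1 h ->
  g = h.
Proof.
move=> Z3 s1 [_ g0 gE] [_ h0 hE]; apply/funext => x.
have [y] := @exists_notin_seq _ _ [:: x] Z3 isT; rewrite inE => yx.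
have [z] := @exists_notin_seq _ _ [:: x; y] Z3 isT.
rewrite !inE negb_or => /andP[zx zy].
have ghE a b : a != b -> g a * g b = h a * h b.
  move=> ab; apply: (@mulIf _ (rho1 (a, b) ^+ 2)).
    by rewrite expf_neq0// separating_neq0.
  by rewrite -gE hE.
have sqE (k : Z -> R) : (forall t, 0 < k t) ->
    k x ^+ 2 = (k x * k y) * (k x * k z) / (k y * k z).
  by move=> k0; field; rewrite !gt_eqF.
have : g x ^+ 2 = h x ^+ 2.
  by rewrite !sqE// !ghE// 1?eq_sym.
by move/eqP; rewrite eqrXn2 ?ltW// => /eqP.
Qed.

(** Equality of the cross-ratios, rewritten as a relation on the quotient of
    the two functions, is the exchange relation under which that
    quotient factorizes. *)
Lemma cross_ratio_exchange rho1 rho2 (f := fun x y => rho2 (x, y) / rho1 (x, y)) :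
  separating_function rho1 -> separating_function rho2 ->
  moebius_equivalent rho1 rho2 ->
  forall xi xi' eta eta', uniq [:: xi; xi'; eta; eta'] ->
  f xi eta * f xi' eta' = f xi eta' * f xi' eta.
Proof.
move=> s1 s2 e12 xi xi' eta eta' u4; have := e12 _ _ _ _ u4.
rewrite /cross_ratio /f.
move: u4; rewrite /= !inE !negb_or -!andbA.
move=> /and5P[_ a b c /and3P[d _ _]] E.
have N (r : Z * Z -> R) : separating_function r ->
    [/\ r (xi, eta) != 0, r (xi, eta') != 0, r (xi', eta) != 0
      & r (xi', eta') != 0].
  by move=> sr; split; exact: separating_neq0.
have [n1 n2 n3 n4] := N _ s1; have [m1 m2 m3 m4] := N _ s2.
transitivity ((rho2 (xi, eta) * rho2 (xi', eta') /
    (rho2 (xi, eta') * rho2 (xi', eta))) *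
  (rho2 (xi, eta') * rho2 (xi', eta)) / (rho1 (xi, eta) * rho1 (xi', eta'))).
  by field; rewrite n1 n4 m2 m3.
by rewrite -E; field; rewrite n1 n2 n3 n4.
Qed.

(** Pointwise this is the factorization of the quotient of the two functions.
    For continuity at [xi], the two auxiliary points chosen for [xi] can be
    used at all nearby points, so that near [xi] the derivative is given by a
    single continuous formula. *)
Lemma is_moebius_derivative_exists rho1 rho2 :
  (`I_3 #<= [set: Z])%card -> separating_function rho1 ->
  separating_function rho2 -> moebius_equivalent rho1 rho2 ->
  exists g, is_moebius_derivative rho2 rho1 g.
Proof.
move=> Z3 s1 s2 e12.
have [f fE] : {f : Z -> Z -> R | forall x y, f x y = rho2 (x, y) / rho1 (x, y)}.
  by exists (fun x y => rho2 (x, y) / rho1 (x, y)).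
have fC x y : f x y = f y x.
  by case: s1 s2 => [_ _ C1 _] [_ _ C2 _]; rewrite !fE C1 C2.
have f_gt0 x y : x != y -> 0 < f x y.
  by move=> ?; rewrite fE divr_gt0 ?separating_gt0.
have f_exchange x x' y y' : uniq [:: x; x'; y; y'] ->
  f x y * f x' y' = f x y' * f x' y.
  by rewrite !fE; exact: cross_ratio_exchange.
have f_indep := factor_indep fC f_gt0 f_exchange.
have [p pP] : {p : Z -> Z * Z & forall xi, uniq [:: xi; (p xi).1; (p xi).2]}.
  apply: (@choice _ _ (fun xi q => is_true (uniq [:: xi; q.1; q.2]))) => x.
  have [y] := @exists_notin_seq _ _ [:: x] Z3 isT; rewrite inE => yx.
  have [z] := @exists_notin_seq _ _ [:: x; y] Z3 isT.
  rewrite !inE negb_or => /andP[zx zy].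
  by exists (y, z); rewrite /= !inE negb_or ![x == _]eq_sym ![y == z]eq_sym yx zx zy.
exists (fun xi => factor f xi (p xi).1 (p xi).2); split=> [xi|xi|xi eta].
- move: (pP xi); set eta := (p xi).1; set zeta := (p xi).2.
  move=> /[dup] u; rewrite /= !inE !negb_or andbT => /andP[/andP[xe xz] ez].
  have rho_cvg (r : Z * Z -> R) t : separating_function r ->
      r (x, t) @[x --> xi] --> r (xi, t).
    by move=> [rc _ _ _]; exact: (continuous_slicel rc).
  have f_cvg t : xi != t -> f x t @[x --> xi] --> f xi t.
    move=> xt; under eq_fun do rewrite fE; rewrite fE.
    apply: cvgM; first exact: rho_cvg.
    by apply: cvgV; [exact: separating_neq0|exact: rho_cvg].
  have far t : xi != t -> \forall x \near xi, x != t.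
    move=> xt; have /(cvgr_gt _)/(_ _ (separating_gt0 s1 xt)) := rho_cvg _ t s1.
    apply: filterS => x; apply: contraTneq => ->.
    by case: s1 => _ _ _ /(_ t t)[_ ->//]; rewrite ltxx.
  apply: (@cvg_trans _ (factor f x eta zeta @[x --> xi])).
    apply: near_eq_cvg; near=> x.
    have xe' : x != eta by near: x; exact: far.
    have xz' : x != zeta by near: x; exact: far.
    by apply: f_indep => //; rewrite /= !inE negb_or xe' xz' ez.
  by apply: cvgM; [apply: cvgM; exact: f_cvg|exact: cvg_cst].
- exact: factor_gt0.
- have [->|xe] := eqVneq xi eta.
    case: s1 s2 => [_ _ _ /(_ eta eta)[_ ->//]] [_ _ _ /(_ eta eta)[_ ->//]].
    by rewrite expr0n /= mulr0.
  have [z] := @exists_notin_seq _ _ [:: xi; eta] Z3 isT.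
  rewrite !inE negb_or => /andP[zx ze].
  have u1 : uniq [:: xi; eta; z].
    by rewrite /= !inE negb_or xe ![_ == z]eq_sym zx ze.
  have u2 : uniq [:: eta; xi; z].
    by rewrite /= !inE negb_or eq_sym xe ![_ == z]eq_sym zx ze.
  rewrite (f_indep _ _ _ _ _ (pP xi) u1) (f_indep _ _ _ _ _ (pP eta) u2).
  rewrite (factorM fC f_gt0)//.
  by rewrite fE exprMn exprVn divfK// expf_neq0// separating_neq0.
Unshelve. all: by end_near. Qed.
End MoebiusDerivative.

(** In the square of a cross-ratio every point occurs once in the numerator
    and once in the denominator, so that the factors [g] cancel. *)
Lemma is_moebius_derivative_equivalent {R : realType} {Z : topologicalType}
  (rho1 rho2 : Z * Z -> R) g :
  separating_function rho1 -> separating_function rho2 ->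
  is_moebius_derivative rho2 rho1 g -> moebius_equivalent rho2 rho1.
Proof.
move=> s1 s2 [_ g0 gE] xi xi' eta eta' /=; rewrite !inE !negb_or -!andbA.
move=> /and5P[_ a b c /and3P[d _ _]].
have cr_ge0 (r : Z * Z -> R) : separating_function r ->
    0 <= cross_ratio r xi xi' eta eta'.
  by move=> [_ r0 _ _]; rewrite divr_ge0// mulr_ge0.
apply/eqP; rewrite -(@eqrXn2 _ 2) ?cr_ge0//; apply/eqP.
rewrite /cross_ratio !exprMn exprVn !exprMn !gE exprVn !exprMn.
by field; rewrite !separating_neq0// !gt_eqF.
Qed.

(** * The metric on the Moebius space *)

Section MoebiusDistance.
Context {R : realType} {Z : topologicalType}.
Context (cZ : compact [set: Z]) (Z3 : (`I_3 #<= [set: Z])%card).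
Implicit Types (rho : Z * Z -> R) (g h : Z -> R).

Lemma moebius_derivativeE rho1 rho2 g : separating_function rho1 ->
  is_moebius_derivative rho2 rho1 g -> moebius_derivative rho2 rho1 = g.
Proof.
move=> s1 dg; apply: (is_moebius_derivative_unique Z3 s1 _ dg).
by apply: (@xgetPex _ (cst 1) [set g | is_moebius_derivative rho2 rho1 g]); exists g.
Qed.

Lemma moebius_derivativeP rho1 rho2 : separating_function rho1 ->
  separating_function rho2 -> moebius_equivalent rho1 rho2 ->
  is_moebius_derivative rho2 rho1 (moebius_derivative rho2 rho1).
Proof.
move=> s1 s2 e12; have [g dg] := is_moebius_derivative_exists Z3 s1 s2 e12.
by rewrite (moebius_derivativeE s1 dg).
Qed.

Lemma sup_norm_ge f z : continuous f -> `|f z| <= sup_norm (f : Z -> R).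
Proof.
move=> fc; rewrite /sup_norm; apply: ub_le_sup; last by exists z.
have : compact (range (fun z => `|f z|)).
  apply: continuous_compact => //; apply: continuous_subspaceT => x.
  exact: cvg_norm (fc x).
by case/compact_has_sup => //; exists `|f z|, z.
Qed.

Lemma sup_norm_le f M : (forall z, `|f z| <= M) -> sup_norm (f : Z -> R) <= M.
Proof.
move=> fM; have [z _] := exists_notin_seq (s := [::]) Z3 isT.
apply: ge_sup; first by exists `|f z|, z.
by move=> _ [x _ <-].
Qed.

Lemma moebius_space_separating rho0 (a : moebius_space rho0) :
  separating_function (\val a).
Proof. by have [[]] := set_mem (valP a). Qed.

Lemma moebius_space_derivative rho0 (a b : moebius_space rho0) :
  is_moebius_derivative (\val a) (\val b) (moebius_derivative (\val a) (\val b)).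
Proof.
apply: moebius_derivativeP; try exact: moebius_space_separating.
have [_ ea] := set_mem (valP a); have [_ eb] := set_mem (valP b).
by move=> *; rewrite ea// eb.
Qed.

Lemma moebius_derivative_chain rho0 (a b c : moebius_space rho0) z :
  moebius_derivative (\val a) (\val c) z =
  moebius_derivative (\val a) (\val b) z * moebius_derivative (\val b) (\val c) z.
Proof.
rewrite (moebius_derivativeE _ (is_moebius_derivative_comp
  (moebius_space_derivative a b) (moebius_space_derivative b c)))//.
exact: moebius_space_separating.
Qed.

Lemma moebius_derivative_inv rho0 (a b : moebius_space rho0) z :
  moebius_derivative (\val a) (\val b) z =
  (moebius_derivative (\val b) (\val a) z)^-1.
Proof.
rewrite (moebius_derivativeE _ (is_moebius_derivative_inv
  (moebius_space_derivative b a)))//.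
exact: moebius_space_separating.
Qed.

Lemma moebius_derivative_gt0 rho0 (a b : moebius_space rho0) z :
  0 < moebius_derivative (\val a) (\val b) z.
Proof. by have [] := moebius_space_derivative a b. Qed.

Lemma ln_moebius_derivative_le rho0 (a b : moebius_space rho0) z :
  `|ln (moebius_derivative (\val b) (\val a) z)| <= moebius_dist a b.
Proof.
apply: (@sup_norm_ge (fun z => ln (moebius_derivative (\val b) (\val a) z)) z).
have [c p _] := moebius_space_derivative b a.
by move=> x; apply: continuous_comp; [exact: c|exact: continuous_ln].
Qed.

Lemma moebius_dist_sym rho0 (a b : moebius_space rho0) :
  moebius_dist a b = moebius_dist b a.
Proof.
rewrite /moebius_dist /sup_norm; congr sup; apply: eq_imagel => z _.
by rewrite moebius_derivative_inv lnV ?normrN// posrE moebius_derivative_gt0.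
Qed.

(** The logarithm of the chain rule. *)
Lemma moebius_dist_triangle rho0 (b a c : moebius_space rho0) :
  moebius_dist a c <= moebius_dist a b + moebius_dist b c.
Proof.
apply: sup_norm_le => z; rewrite (moebius_derivative_chain c b a).
rewrite lnM ?posrE ?moebius_derivative_gt0// addrC.
by rewrite (le_trans (ler_normD _ _))// lerD// ln_moebius_derivative_le.
Qed.

End MoebiusDistance.

(** * The exponential of the Gromov product on the compactification *)

Section VisualKernel.
Context {R : realType} {X : metricType R} {Xhat : topologicalType} {j : X -> Xhat}.
Context (hj : gromov_product_compactification j).

(** The continuous extension of [exp (- (a | b)_x)] to the compactification.
    Working with the exponential replaces extended real values by numbers of
    [0, 1] and the condition [(a | b)_x = +oo] by an equation. *)
Definition visual_kernel (x : X) (p : Xhat * Xhat) : R :=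
  fine (expeR (- gromov_extension j x p))%E.

Local Notation K := visual_kernel.

Let gromov_extensionP x : is_gromov_extension j x (gromov_extension j x).
Proof. by apply: xgetPex; have [_] := hj; exact. Qed.

Let dense_j : dense (range j). Proof. by have [[]] := hj. Qed.

Lemma visual_kernel_continuous x : continuous (K x).
Proof.
have [Gc G0 _ _] := gromov_extensionP x.
move=> p; apply: (@continuous_comp _ _ _ (gromov_extension j x)
  (fun v => fine (expeR (- v))%E)); first exact: Gc.
exact/fine_expeRN_continuous/G0.
Qed.

Lemma visual_kernelE x y z : K x (j y, j z) = expR (- gromov_product x y z).
Proof. by have [_ _ GE _] := gromov_extensionP x; rewrite /K GE. Qed.

Lemma visual_kernel_diag x y : K x (j y, j y) = expR (- mdist x y).
Proof.
by rewrite visual_kernelE /gromov_product mdistxx; congr expR; field.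
Qed.

Lemma visual_kernel_ge0 x p : 0 <= K x p.
Proof. by rewrite /K fine_ge0// expeR_ge0. Qed.

Lemma visual_kernel_le1 x p : K x p <= 1.
Proof.
have [_ G0 _ _] := gromov_extensionP x; rewrite /K; have := G0 p.
case: (gromov_extension j x p) => [r|_|//] /=; last exact: ler01.
by rewrite lee_fin => r0; rewrite -expR0 ler_expR oppr_le0.
Qed.

Lemma visual_kernel_eq0 x xi eta : (~` range j) xi -> (~` range j) eta ->
  K x (xi, eta) = 0 <-> xi = eta.
Proof.
move=> bxi beta; have [_ G0 _ /(_ _ _ bxi beta) <-] := gromov_extensionP x.
rewrite /K; have := G0 (xi, eta).
case: (gromov_extension j x (xi, eta)) => [r _|_|//] /=; last by split.
by split=> //; move/eqP; rewrite gt_eqF// expR_gt0.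
Qed.

Lemma visual_closed_ind (A : set Xhat) :
  closed A -> (forall y, A (j y)) -> forall a, A a.
Proof. by move=> cA jA; apply: (closed_dense dense_j cA) => _ [y _ <-]. Qed.

Lemma visual_closed_ind2 (A : set (Xhat * Xhat)) :
  closed A -> (forall y z, A (j y, j z)) -> forall p, A p.
Proof.
move=> cA jA; apply: (closed_dense (dense_setX dense_j dense_j) cA).
by move=> [_ _] [/= [y _ <-] [z _ <-]].
Qed.

Lemma visual_kernel_sym x a b : K x (a, b) = K x (b, a).
Proof.
pose A := [set p : Xhat * Xhat | K x p = K x (p.2, p.1)].
apply: (visual_closed_ind2 (A := A) _ _ (a, b)) => [|y z].
  apply: closed_eq_continuous; first exact: visual_kernel_continuous.
  move=> p; apply: (cvg_comp _ _ (cvg_pair cvg_snd cvg_fst)).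
  exact: visual_kernel_continuous.
rewrite /A /= !visual_kernelE /gromov_product [mdist z y]metric_sym.
by rewrite [mdist x z + _]addrC.
Qed.

Lemma visual_kernel_ge_expR x y a : expR (- mdist x y) <= K x (j y, a).
Proof.
apply: (visual_closed_ind (A := [set a | expR (- mdist x y) <= K x (j y, a)])).
  apply: closed_le_continuous; first by move=> ?; exact: cvg_cst.
  exact/continuous_slicer/visual_kernel_continuous.
move=> z /=; rewrite visual_kernelE ler_expR lerN2 /gromov_product.
by have := metric_triangle x y z; lra.
Qed.

Lemma visual_kernel_gt0 x y a : 0 < K x (j y, a).
Proof. exact: lt_le_trans (expR_gt0 _) (visual_kernel_ge_expR x y a). Qed.

(** The exponential of the Busemann function [a |-> d(x, a) - d(y, a)],
    which extends to the boundary because it is [2 (y | a)_x - d(x, y)]. *)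
Definition busemann_factor x y a : R := expR (- mdist x y) / K x (j y, a) ^+ 2.

Lemma busemann_factor_gt0 x y a : 0 < busemann_factor x y a.
Proof. by rewrite divr_gt0 ?expR_gt0// exprn_gt0// visual_kernel_gt0. Qed.

Lemma busemann_factor_continuous x y : continuous (busemann_factor x y).
Proof.
move=> a; apply: cvgM; first exact: cvg_cst.
apply: cvgV; first by rewrite gt_eqF// exprn_gt0// visual_kernel_gt0.
apply: (continuous_sqr (f := fun b => K x (j y, b))).
exact/continuous_slicer/visual_kernel_continuous.
Qed.

Lemma busemann_factor_le x y a : busemann_factor x y a <= expR (mdist x y).
Proof.
rewrite ler_pdivrMr ?exprn_gt0 ?visual_kernel_gt0//.
rewrite [leLHS](_ : _ = expR (mdist x y) * expR (- mdist x y) ^+ 2).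
  by rewrite ler_pM2l ?expR_gt0// lerXn2r ?nnegrE ?expR_ge0 ?visual_kernel_ge0//
    visual_kernel_ge_expR.
by rewrite expr2 mulrA -expRD subrr expR0 mul1r.
Qed.

Lemma busemann_factor_ge x y a : expR (- mdist x y) <= busemann_factor x y a.
Proof.
rewrite ler_pdivlMr ?exprn_gt0 ?visual_kernel_gt0// ler_piMr ?expR_ge0//.
by rewrite expr_le1 ?visual_kernel_ge0 ?visual_kernel_le1.
Qed.

(** For points of [X] this is the identity
    [2 (a | b)_x - 2 (a | b)_y = (d(x,a) - d(y,a)) + (d(x,b) - d(y,b))]. *)
Lemma visual_kernel_change x y a b :
  K y (a, b) ^+ 2 =
  busemann_factor x y a * busemann_factor x y b * K x (a, b) ^+ 2.
Proof.
pose A := [set p : Xhat * Xhat | K y p ^+ 2 =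
  busemann_factor x y p.1 * busemann_factor x y p.2 * K x p ^+ 2].
have sqr_cont z : continuous (fun p => K z p ^+ 2).
  exact: (continuous_sqr (@visual_kernel_continuous z)).
apply: (visual_closed_ind2 (A := A) _ _ (a, b)) => [|u v].
  apply: closed_eq_continuous; first exact: sqr_cont.
  move=> p; apply: cvgM; last exact: sqr_cont.
  apply: cvgM.
    by apply: (cvg_comp fst _ cvg_fst); exact: busemann_factor_continuous.
  by apply: (cvg_comp snd _ cvg_snd); exact: busemann_factor_continuous.
rewrite /A /= /busemann_factor !visual_kernelE.
rewrite -!expRM_natl -!expRN -!expRD; congr expR.
by rewrite /gromov_product; field.
Qed.

Lemma range_visual_kernel x a : range j a <-> 0 < K x (a, a).
Proof.
split=> [[y _ <-]|Kaa]; first by rewrite visual_kernel_diag expR_gt0.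
apply: contrapT => ba; have [_ /(_ erefl)] := visual_kernel_eq0 x ba ba.
by move=> K0; rewrite K0 ltxx in Kaa.
Qed.

Lemma visual_kernel_diag_continuous x : continuous (fun a => K x (a, a)).
Proof.
move=> a; apply: (cvg_comp _ _ (cvg_pair cvg_id cvg_id)).
exact: visual_kernel_continuous.
Qed.

(** The boundary is the zero set of the continuous function
    [a |-> K x (a, a)], whence [X] is open in its compactification. *)
Lemma closed_boundary (x : X) : closed (~` range j).
Proof.
have -> : ~` range j = [set a | K x (a, a) <= 0].
  apply/seteqP; split=> [a na|a Ka ja] /=.
    by rewrite leNgt; apply/negP => /range_visual_kernel.
  by have /(range_visual_kernel x) := ja; rewrite ltNge Ka.
apply: closed_le_continuous; first exact: visual_kernel_diag_continuous.
by move=> ?; exact: cvg_cst.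
Qed.

End VisualKernel.
Arguments visual_kernel {R X Xhat} j x p.
Arguments busemann_factor {R X Xhat} j x y a.

(** * Geodesic lines and their endpoints *)

Lemma geodesic_line {R : realType} (X : metricType R) (x y : X) :
  geodesic_metric X -> geodesically_complete X -> x <> y ->
  exists c : R -> X,
    [/\ forall s t, mdist (c s) (c t) = `|s - t|, c 0 = x & c (mdist x y) = y].
Proof.
move=> gX gcX /eqP xy; have d0 : 0 < mdist x y by rewrite mdist_gt0.
have [c [ci c0 cd]] := gX x y; have [c' [c'i c'c]] := gcX _ _ _ d0 ci.
exists c'; split=> [s t||]; first exact: c'i.
- by rewrite c'c// in_itv /= lexx ltW.
- by rewrite c'c// in_itv /= lexx ltW.
Qed.

Section Boundary.
Context {R : realType} {X : metricType R} {Xhat : topologicalType} {j : X -> Xhat}.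
Context (hj : gromov_product_compactification j).
Context (gX : geodesic_metric X) (gcX : geodesically_complete X).
Local Notation K := (visual_kernel j).

Let cXhat : compact [set: Xhat]. Proof. by have [[[]]] := hj. Qed.
Let hXhat : hausdorff_space Xhat. Proof. by have [[[]]] := hj. Qed.

(** The pairs [(a, b)] with [(a | b)_x = 0] and with [a] and [b] equidistant
    from [x] form a compact set.  Its first projection contains [X], by
    reflection through [x] along a complete geodesic, hence everything.  The
    equidistance condition forces the partner of a boundary point to be at
    infinite distance from [x], thus on the boundary. *)
Lemma boundary_antipode x xi : (~` range j) xi ->
  exists2 eta, (~` range j) eta & K x (xi, eta) = 1.
Proof.
move=> bxi.
pose P := [set p : Xhat * Xhat | K x p = 1] `&`
  [set p : Xhat * Xhat | K x (p.1, p.1) = K x (p.2, p.2)].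
have cP : closed P.
  apply: closedI; apply: closed_eq_continuous.
  - exact: visual_kernel_continuous.
  - by move=> ?; exact: cvg_cst.
  - move=> p; apply: (cvg_comp fst (fun a => K x (a, a)) cvg_fst).
    exact: visual_kernel_diag_continuous.
  - move=> p; apply: (cvg_comp snd (fun a => K x (a, a)) cvg_snd).
    exact: visual_kernel_diag_continuous.
have jP y : (fst @` P) (j y).
  have [<-|/eqP xy] := eqVneq x y.
    exists (j x, j x) => //; split => //=.
    by rewrite visual_kernel_diag// mdistxx oppr0 expR0.
  have [c [ci c0 cd]] := geodesic_line gX gcX xy.
  have d0 := mdist_ge0 x y.
  have dx : mdist x (c (- mdist x y)) = mdist x y.
    by rewrite -{1}c0 ci opprK add0r ger0_norm.
  have dy : mdist y (c (- mdist x y)) = mdist x y + mdist x y.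
    by rewrite -{1}cd ci opprK ger0_norm// addr_ge0.
  exists (j y, j (c (- mdist x y))) => //; split=> /=.
    by rewrite visual_kernelE// /gromov_product dx dy subrr mulr0 oppr0 expR0.
  by rewrite !visual_kernel_diag// dx.
have := visual_closed_ind hj (closed_projection hXhat cXhat cXhat cP) jP xi.
move=> [[a eta] [/= K1 Kd] /= axi]; subst a.
exists eta => // /(range_visual_kernel hj x); rewrite -Kd.
by move/(range_visual_kernel hj x).
Qed.

(** On a ray from [x] through [y], [(y | c t)_x] is constantly [d (x, y)] from
    [y] on.  If the compact set of all [a] with [(y | a)_x = d (x, y)] avoided
    the boundary, the distance to [x] would be bounded on it, contradicting
    that the ray is unbounded.  When [x = y] there is no ray, but any boundary
    point [xi] will do. *)
Lemma busemann_factor_attained x y xi : (~` range j) xi ->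
  exists2 eta, (~` range j) eta & busemann_factor j x y eta = expR (mdist x y).
Proof.
move=> bxi.
suff [eta beta Keta] : exists2 eta, (~` range j) eta &
    K x (j y, eta) = expR (- mdist x y).
  exists eta => //; rewrite /busemann_factor Keta expr2 invfM mulrA.
  by rewrite divff ?mul1r ?gt_eqF ?expR_gt0// expRN invrK.
have [<-|/eqP xy] := eqVneq x y.
  exists xi => //; apply/eqP; rewrite eq_le mdistxx oppr0 expR0 visual_kernel_le1//.
  by rewrite -{1}expR0 -oppr0 -(mdistxx x) visual_kernel_ge_expR.
have [c [ci c0 cd]] := geodesic_line gX gcX xy.
pose A := [set a | K x (j y, a) = expR (- mdist x y)].
have cA : compact A.
  apply: subclosed_compact cXhat _ => //.
  apply: closed_eq_continuous; last by move=> ?; exact: cvg_cst.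
  exact/continuous_slicer/visual_kernel_continuous.
have dxc t : 0 <= t -> mdist x (c t) = t.
  by move=> t0; rewrite -{1}c0 ci sub0r normrN ger0_norm.
have Ac t : mdist x y <= t -> A (j (c t)).
  move=> dt; rewrite /A /= visual_kernelE// /gromov_product.
  rewrite dxc ?(le_trans (mdist_ge0 _ _) dt)//.
  rewrite -{2}cd ci distrC ger0_norm ?subr_ge0//.
  by congr (expR (- _)); field.
apply: contrapT => nA.
have Aj a : A a -> range j a.
  by move=> Aa; apply: contrapT => ba; apply: nA; exists a.
have A0 : A !=set0 by exists (j (c (mdist x y))); exact: Ac.
have [|a] := compact_EVT_min (f := fun a => K x (a, a)) A0 cA.
  exact/continuous_subspaceT/visual_kernel_diag_continuous.
rewrite inE => /Aj [w _ <-] wmin.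
have dxy := mdist_ge0 x y; have dxw := mdist_ge0 x w.
pose t := mdist x y + mdist x w + 1.
have t0 : 0 <= t by rewrite !addr_ge0.
have dt : mdist x y <= t by rewrite /t -addrA lerDl addr_ge0.
have := wmin (j (c t)); rewrite inE !visual_kernel_diag// => /(_ (Ac _ dt)).
by rewrite ler_expR lerN2 dxc// /t; lra.
Qed.

End Boundary.

(** * The isometric embedding *)

Section Embedding.
Context {R : realType} {X : metricType R} {Xhat : topologicalType} {j : X -> Xhat}.
Context (hj : gromov_product_compactification j).
Context (gX : geodesic_metric X) (gcX : geodesically_complete X).
Local Notation K := (visual_kernel j).
Local Notation Z := (gromov_boundary j).
Local Notation rho := (visual_function j).

Let cXhat : compact [set: Xhat]. Proof. by have [[[]]] := hj. Qed.
Let hXhat : hausdorff_space Xhat. Proof. by have [[[]]] := hj. Qed.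

Lemma gromov_boundaryP (xi : Z) : (~` range j) (\val xi).
Proof. exact: set_valP. Qed.
Arguments gromov_boundaryP xi _ : clear implicits.

Lemma gromov_boundary_val (a : Xhat) : (~` range j) a -> exists xi : Z, \val xi = a.
Proof. by move=> ba; exists (exist _ a (mem_set ba)). Qed.

Lemma val_continuous : continuous (\val : Z -> Xhat).
Proof. exact: initial_continuous. Qed.

Lemma visual_separating x : separating_function (rho x).
Proof.
split=> [p|xi eta|xi eta|xi eta].
- have c1 : (\val q.1 : Xhat) @[q --> p] --> (\val p.1 : Xhat).
    by apply: (@continuous_comp _ _ _ fst (\val : Z -> Xhat));
      [exact: cvg_fst|exact: val_continuous].
  have c2 : (\val q.2 : Xhat) @[q --> p] --> (\val p.2 : Xhat).
    by apply: (@continuous_comp _ _ _ snd (\val : Z -> Xhat));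
      [exact: cvg_snd|exact: val_continuous].
  pose v (q : Z * Z) : Xhat * Xhat := (\val q.1, \val q.2).
  have vc : {for p, continuous v} by exact: cvg_pair.
  apply: (@continuous_comp _ _ _ v (K x) p vc).
  exact: visual_kernel_continuous.
- exact: visual_kernel_ge0.
- exact: visual_kernel_sym.
- split=> [/(visual_kernel_eq0 hj x (gromov_boundaryP xi) (gromov_boundaryP eta))|->].
    exact: val_inj.
  exact/visual_kernel_eq0/erefl/gromov_boundaryP/gromov_boundaryP.
Qed.

Lemma visual_antipodal x (xi0 : Z) : antipodal_function (rho x).
Proof.
have anti (xi : Z) : exists eta, rho x (xi, eta) = 1.
  have [_ /gromov_boundary_val[eta <-] K1] :=
    boundary_antipode hj gX gcX x (gromov_boundaryP xi).
  by exists eta.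
split=> //; first exact: visual_separating.
have [eta eta1] := anti xi0.
have le1 : ubound (range (rho x)) 1 by move=> _ [p _ <-]; exact: visual_kernel_le1.
apply/eqP; rewrite eq_le; apply/andP; split.
  by apply: ge_sup => //; exists (rho x (xi0, eta)), (xi0, eta).
by rewrite -{1}eta1; apply: ub_le_sup; [exists 1|exists (xi0, eta)].
Qed.

Lemma visual_derivative x y :
  is_moebius_derivative (rho y) (rho x) (fun xi => busemann_factor j x y (\val xi)).
Proof.
split=> [xi|xi|xi eta].
- apply: (@continuous_comp _ _ _ (\val : Z -> Xhat) (busemann_factor j x y)).
    exact: val_continuous.
  exact: busemann_factor_continuous.
- exact: busemann_factor_gt0.
- exact: visual_kernel_change.
Qed.

Lemma visual_moebius_subproof (x0 x : X) (xi0 : Z) :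
  rho x \in [set r | antipodal_function r /\ moebius_equivalent r (rho x0)].
Proof.
apply/mem_set; split; first exact: visual_antipodal.
exact: (is_moebius_derivative_equivalent (visual_separating x0)
  (visual_separating x) (visual_derivative x0 x)).
Qed.

(** The boundary point [xi0] is a witness that the boundary is not empty, without
    which no function on it has supremum 1. *)
Definition visual_embedding (x0 : X) (xi0 : Z) (x : X) : moebius_space (rho x0) :=
  exist _ (rho x) (visual_moebius_subproof x0 x xi0).

Context (Z3 : (`I_3 #<= [set: Z])%card) (x0 : X) (xi0 : Z).
Local Notation iX := (visual_embedding x0 xi0).

Lemma gromov_boundary_compact : compact [set: Z].
Proof. exact: compact_set_type cXhat (closed_boundary hj x0). Qed.

Let cZ := gromov_boundary_compact.

Lemma visual_embedding_derivative x y xi :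
  moebius_derivative (\val (iX y)) (\val (iX x)) xi =
  busemann_factor j x y (\val xi).
Proof.
by rewrite (moebius_derivativeE Z3 (visual_separating x) (visual_derivative x y)).
Qed.

(** The logarithm of the derivative is bounded by [d (x, y)] in absolute value,
    and the endpoint of a ray from [x] through [y] realizes this bound. *)
Lemma visual_embedding_isometry x y : moebius_dist (iX x) (iX y) = mdist x y.
Proof.
apply/eqP; rewrite eq_le; apply/andP; split.
  apply: (sup_norm_le Z3) => xi; rewrite visual_embedding_derivative.
  have b0 := busemann_factor_gt0 hj x y (\val xi).
  rewrite ler_norml; apply/andP; split.
    by rewrite -[leLHS]expRK ler_ln ?posrE ?expR_gt0// busemann_factor_ge.
  by rewrite -[leRHS]expRK ler_ln ?posrE ?expR_gt0// busemann_factor_le.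
have [_ /gromov_boundary_val[eta <-] etaE] :=
  busemann_factor_attained hj gX gcX x y (gromov_boundaryP xi0).
have := ln_moebius_derivative_le cZ Z3 (iX x) (iX y) eta.
by rewrite visual_embedding_derivative etaE expRK ger0_norm ?mdist_ge0.
Qed.

End Embedding.
Arguments gromov_boundaryP {R X Xhat j} xi _.

(** * Continuity of the extension to the boundary *)

(** A generated open set is a union of finite intersections of generators, so
    it is enough to look at the preimages of the generators. *)
Lemma maxima_continuous {R : realType} {Z T : topologicalType} (rho0 : Z * Z -> R)
  (rho1 : moebius_space rho0) (f : T -> maxima_compactification rho1) :
  (forall B, maxima_basis rho1 B -> open (f @^-1` B)) -> continuous f.
Proof.
move=> fB t N; rewrite nbhsE => - [W [oW Wt] WN].
have [D DP DE] := oW; move: Wt; rewrite -DE => - [A DA At].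
have [F FB FA] := DP _ DA; move: DA At; rewrite -FA => DA Ft.
have FN : nbhs t (\bigcap_(B in [set B | B \in (F : {fset set _})]) (f @^-1` B)).
  apply: filter_bigI => B BF.
  apply: open_nbhs_nbhs; split; last exact: Ft.
  by apply: fB; exact: set_mem (FB _ BF).
apply: filterS FN => s Fs; apply: WN; rewrite -DE.
by eexists; [exact: DA|exact: Fs].
Qed.

Section Extension.
Context {R : realType} {X : metricType R} {Xhat : topologicalType} {j : X -> Xhat}.
Context (hj : gromov_product_compactification j) (pX : proper_metric X).
Context (gX : geodesic_metric X) (gcX : geodesically_complete X).
Local Notation K := (visual_kernel j).
Local Notation Z := (gromov_boundary j).
Local Notation rho := (visual_function j).
Context (Z3 : (`I_3 #<= [set: Z])%card) (x0 : X) (xi0 : Z).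
Local Notation iX := (visual_embedding hj gX gcX x0 xi0).

Let cXhat : compact [set: Xhat]. Proof. by have [[[]]] := hj. Qed.
Let hXhat : hausdorff_space Xhat. Proof. by have [[[]]] := hj. Qed.
Let inj_j : injective j. Proof. by have [[_ _ []]] := hj. Qed.
Let openE_j (U : set X) : open U <-> exists2 V, open V & U = j @^-1` V.
Proof. by have [[_ _ []]] := hj. Qed.
Let cZ := gromov_boundary_compact hj x0.
Let isoX := visual_embedding_isometry hj gX gcX Z3 x0 xi0.

Let continuous_j : continuous j.
Proof. by apply/continuousP => V oV; apply/openE_j; exists V. Qed.

Lemma moebius_dist_visual_continuous r :
  continuous (fun x => moebius_dist r (iX x)).
Proof.
apply: lipschitz1_continuous => x y; rewrite metric_sym -isoX.
exact: moebius_dist_triangle.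
Qed.

Lemma open_image_j (W : set X) : open W -> open (j @` W).
Proof.
move=> /openE_j[V oV ->].
have -> : j @` (j @^-1` V) = V `&` range j.
  apply/seteqP; split=> [_ [x Vx <-]|a [Va [x _ xa]]].
    by split => //; exists x.
  by exists x => //; rewrite /= xa.
by apply: openI => //; rewrite -closedC; exact: closed_boundary.
Qed.

(** The embedding being isometric, the set of [x] is closed and bounded in [X],
    hence compact because [X] is proper. *)
Lemma closed_moebius_ball (r : moebius_space (rho x0)) e :
  closed (j @` [set x | moebius_dist r (iX x) <= e]).
Proof.
apply: compact_closed => //; apply: continuous_compact.
  exact: continuous_subspaceT.
apply: (subclosed_compact _ (@pX x0 (moebius_dist (iX x0) r + e))).
  apply: closed_le_continuous; first exact: moebius_dist_visual_continuous.
  by move=> ?; exact: cvg_cst.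
move=> x /= re; rewrite -isoX (le_trans (moebius_dist_triangle cZ Z3 r _ _))//.
by rewrite lerD2l.
Qed.

Context (rho1 : moebius_space (rho x0)).
Let k := moebius_derivative (\val rho1) (\val (iX x0)).

Let k_gt0 xi : 0 < k xi.
Proof. exact: moebius_derivative_gt0. Qed.

Let k_continuous : continuous k.
Proof. by have [] := moebius_space_derivative Z3 rho1 (iX x0). Qed.

(** For [a] in [X] the pairs [(a, eta)] describe the maximizers of the
    derivative of [rho_a] with respect to [rho1]; the formula retains a meaning
    when [a] is a boundary point, where no such derivative exists. *)
Definition minimizers : set (Xhat * Z) :=
  [set p | forall w, K x0 (p.1, \val p.2) ^+ 2 * k p.2 <= K x0 (p.1, \val w) ^+ 2 * k w].

Lemma closed_minimizers : closed minimizers.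
Proof.
have -> : minimizers = \bigcap_(w : Z) [set p | K x0 (p.1, \val p.2) ^+ 2 * k p.2 <=
    K x0 (p.1, \val w) ^+ 2 * k w].
  by apply/seteqP; split=> [p pm w _|p pm w]; exact: pm.
have Kc (v : Xhat * Z -> Xhat) : continuous v ->
    continuous (fun p => K x0 (p.1, v p) ^+ 2).
  move=> vc; apply: (continuous_sqr (f := fun p => K x0 (p.1, v p))) => p.
  pose u (q : Xhat * Z) := (q.1, v q).
  apply: (@continuous_comp _ _ _ u (K x0)).
    by apply: cvg_pair; [exact: cvg_fst|exact: vc].
  exact: visual_kernel_continuous.
apply: closed_bigI => w _; apply: closed_le_continuous => p; apply: cvgM.
- apply: Kc => q; apply: (@continuous_comp _ _ _ snd (\val : Z -> Xhat)).
    exact: cvg_snd.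
  exact: val_continuous.
- apply: (@continuous_comp _ _ _ snd k); first exact: cvg_snd.
  exact: k_continuous.
- by apply: (Kc (cst (\val w))) => q; exact: cvg_cst.
- exact: cvg_cst.
Qed.

(** The derivative is the product of the derivative of [rho_x] with respect to
    [rho_x0], which is [exp (- d (x0, x)) / K x0 (x, eta) ^+ 2], and of
    [1 / k eta]; so it is inversely proportional to the function that is
    minimized. *)
Lemma minimizers_argmax x :
  [set eta | minimizers (j x, eta)] =
  argmax (moebius_derivative (\val (iX x)) (\val rho1)).
Proof.
have gE eta : moebius_derivative (\val (iX x)) (\val rho1) eta =
    expR (- mdist x0 x) / (K x0 (j x, \val eta) ^+ 2 * k eta).
  rewrite (moebius_derivative_chain Z3 _ (iX x0)) visual_embedding_derivative//.
  rewrite (moebius_derivative_inv Z3 (iX x0) rho1) /busemann_factor -/k.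
  by field; rewrite !gt_eqF// visual_kernel_gt0.
have Kk_gt0 eta : 0 < K x0 (j x, \val eta) ^+ 2 * k eta.
  by rewrite mulr_gt0// exprn_gt0// visual_kernel_gt0.
apply/seteqP; split=> eta /= me w; have := me w; rewrite !gE.
  by rewrite ler_pM2l ?expR_gt0// lef_pV2 ?posrE.
by rewrite ler_pM2l ?expR_gt0// lef_pV2 ?posrE.
Qed.

(** At [eta = xi] the function to be minimized vanishes, and it is positive
    elsewhere. *)
Lemma minimizers_boundary (xi eta : Z) : minimizers (\val xi, eta) <-> eta = xi.
Proof.
have K0 (zeta : Z) : K x0 (\val xi, \val zeta) = 0 <-> \val xi = \val zeta.
  exact: visual_kernel_eq0 (gromov_boundaryP xi) (gromov_boundaryP zeta).
have Kxi : K x0 (\val xi, \val xi) = 0 by apply/K0.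
split=> [/(_ xi) /=|-> w /=]; rewrite Kxi expr0n /= mul0r.
  rewrite pmulr_lle0// => Ke; apply/esym/val_inj/K0.
  by apply/eqP; rewrite -sqrf_eq0 eq_le Ke sqr_ge0.
by rewrite mulr_ge0 ?sqr_ge0// ltW.
Qed.

(** A point [a] belongs to the preimage exactly when all its minimizers lie in
    [U] and it is not one of the points [x] of [X] with
    [d (rho1, i_X x) <= r].  Both conditions are open, the first because the
    boundary is compact and projection along a compact factor is closed. *)
Lemma open_maxima_nbhd (f : Xhat -> maxima_compactification rho1) U r :
  (forall x, f (j x) = inl (iX x)) -> (forall xi : Z, f (\val xi) = inr xi) ->
  open U -> open (f @^-1` (maxima_nbhd rho1 U r)).
Proof.
move=> fj fb oU.
pose P := minimizers `&` snd @^-1` (~` U).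
have cP : closed (fst @` P).
  apply: closed_projection => //; apply: closedI; first exact: closed_minimizers.
  apply: preimage_closed; last exact: open_closedC.
  by move=> p _; exact: cvg_snd.
have -> : f @^-1` (maxima_nbhd rho1 U r) =
    ~` (fst @` P) `&` ~` (j @` [set x | moebius_dist rho1 (iX x) <= r]).
  apply/seteqP; split=> a.
    case=> [[xi Uxi fa]|[r' [argU rd] fa]].
    - have [[x _ xa]|/gromov_boundary_val[eta etaa]] := pselect (range j a).
        by move: fa; rewrite -xa fj.
      move: fa; rewrite -etaa fb => -[xieta]; subst eta a; split.
        move=> [[b eta] [+ +] /= bE]; subst b.
        by move/minimizers_boundary => -> /=.
      by move=> [x _ xa]; apply: (gromov_boundaryP xi); exists x.
    - have [[x _ xa]|/gromov_boundary_val[eta etaa]] := pselect (range j a); last first.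
        by move: fa; rewrite -etaa fb.
      move: fa; rewrite -xa fj => -[fa]; subst r' a; split.
        move=> [[b eta] [+ +] /= bE]; subst b => Meta /=; apply.
        by apply: argU; rewrite -minimizers_argmax.
      move=> [y yd /inj_j yx]; subst y; move: rd.
      by rewrite moebius_dist_sym// ltNge yd.
  move=> [nP nd]; have [[x _ xa]|/gromov_boundary_val[eta etaa]] := pselect (range j a).
    subst a; right; exists (iX x); last by rewrite fj.
    split.
      rewrite -minimizers_argmax => eta Meta; apply: contrapT => nU.
      by apply: nP; exists (j x, eta).
    rewrite moebius_dist_sym// ltNge; apply/negP => dr; apply: nd.
    by exists x.
  subst a; left; exists eta; last by rewrite fb.
  apply: contrapT => nU; apply: nP; exists (\val eta, eta) => //; split=> //.
  exact/minimizers_boundary.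
by apply: openI; apply: closed_openC => //; exact: closed_moebius_ball.
Qed.

(** The preimage is the image in the compactification of a subset of [X] that
    is open because the distance to a fixed element of the Moebius space is
    continuous along the isometric embedding. *)
Lemma open_maxima_ball (f : Xhat -> maxima_compactification rho1) r e :
  (forall x, f (j x) = inl (iX x)) -> (forall xi : Z, f (\val xi) = inr xi) ->
  open (f @^-1` (maxima_ball rho1 r e)).
Proof.
move=> fj fb.
have -> : f @^-1` (maxima_ball rho1 r e) = j @` [set x | moebius_dist r (iX x) < e].
  apply/seteqP; split=> [a [r' r'e fa]|_ [x xe <-]]; last first.
    by exists (iX x); rewrite ?fj.
  have [[x _ xa]|/gromov_boundary_val[eta etaa]] := pselect (range j a).
    by move: fa; rewrite -xa fj => -[fa]; subst r'; exists x.
  by move: fa; rewrite -etaa fb.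
apply: open_image_j.
have -> : [set x | moebius_dist r (iX x) < e] =
    ~` [set x | e <= moebius_dist r (iX x)].
  by apply/seteqP; split=> x /=; rewrite ltNge => /negP.
apply/closed_openC/closed_le_continuous; last exact: moebius_dist_visual_continuous.
by move=> ?; exact: cvg_cst.
Qed.

Lemma visual_embedding_extension :
  exists f : Xhat -> maxima_compactification rho1,
    [/\ continuous f, forall x, f (j x) = inl (iX x) &
        forall xi : Z, f (\val xi) = inr xi].
Proof.
have [f fP] : {f : Xhat -> maxima_compactification rho1 & forall a,
    (forall x, j x = a -> f a = inl (iX x)) /\
    (forall xi : Z, \val xi = a -> f a = inr xi)}.
  apply: (@choice _ _ (fun a (t : maxima_compactification rho1) =>
    (forall x, j x = a -> t = inl (iX x)) /\
    (forall xi : Z, \val xi = a -> t = inr xi))) => a.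
  have [[x _ xa]|ba] := pselect (range j a).
    exists (inl (iX x)); split=> [y|xi].
      by rewrite -xa => /inj_j ->.
    by move=> xia; case: (gromov_boundaryP xi); exists x => //; rewrite xia.
  have [eta etaa] := gromov_boundary_val ba; exists (inr eta); split=> [y ya|xi].
    by case: ba; exists y.
  by rewrite -etaa => /val_inj ->.
have fj x : f (j x) = inl (iX x) by apply: (fP _).1.
have fb (xi : Z) : f (\val xi) = inr xi by apply: (fP _).2.
exists f; split=> //; apply: maxima_continuous => B [].
  by move=> [r [e [_ ->]]]; exact: open_maxima_ball.
by move=> [U [r [oU _ ->]]]; exact: open_maxima_nbhd.
Qed.

End Extension.

Theorem proposition5p10 (R : realType) (X : metricType R)
    (hX : gromov_product_space X)
    (Xhat : topologicalType) (j : X -> Xhat)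
    (hj : gromov_product_compactification j)
    (h4 : (`I_4 #<= [set: gromov_boundary j])%card)
    (x0 : X) :
  exists iX : X -> moebius_space (visual_function j x0),
    [/\ forall x : X, \val (iX x) = visual_function j x,
        forall x y : X, moebius_dist (iX x) (iX y) = mdist x y &
        forall rho1 : moebius_space (visual_function j x0),
          exists iXhat : Xhat -> maxima_compactification rho1,
            [/\ continuous iXhat,
                forall x : X, iXhat (j x) = inl (iX x) &
                forall xi : gromov_boundary j, iXhat (\val xi) = inr xi]].
Proof.
have [pX gX gcX _] := hX.
have h3 : (`I_3 #<= [set: gromov_boundary j])%card.
  by apply: (card_le_trans _ h4); apply: subset_card_le => i /= /ltnW.
have [xi0 _] := exists_notin_seq (s := [::]) h3 isT.
exists (visual_embedding hj gX gcX x0 xi0); split=> // [x y|rho1].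
  exact: visual_embedding_isometry.
exact: visual_embedding_extension.
Qed.
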